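(* Let $A=(a_{ij})\in M_n(\mathbb{H})$ with $a_{ii}\in\mathbb{R}$ for all $1\le i\le n$, let $\gamma\in[0,1]$, and let $p,q\in(1,\infty)$ with $\frac1p+\frac1q=1$. Then all the right eigenvalues of $A$ are contained in the union of the $n$ generalized balls $$B_i(A):=\left\{z\in\mathbb{H}: |z-a_{ii}|\le (n-1)^{\frac{1-\gamma}{q}}\,r_i(A)^{\gamma}\,\bigl(n_i^{(p)}(A)\bigr)^{1-\gamma}\right\},\qquad 1\le i\le n;$$ that is, $\Lambda_r(A)\subseteq B(A):=\bigcup_{i=1}^n B_i(A)$.
   Context: $\mathbb{H}$ is the skew field of real quaternions with its usual modulus $|\cdot|$, and $M_n(\mathbb{H})$ is the set of $n\times n$ quaternionic matrices. A quaternion $\lambda$ is a right eigenvalue of $A$ if $Ax=x\lambda$ for some nonzero column vector $x\in\mathbb{H}^n$; $\Lambda_r(A)$ is the set of right eigenvalues. $r_i(A):=\sum_{j\ne i}|a_{ij}|$ and $n_i^{(p)}(A):=\bigl(\sum_{j\neq i}|a_{ij}|^p\bigr)^{1/p}$. Convention: $0^0=1$. *)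

(* Defs.v *)
From HB Require Import structures.
From mathcomp Require Import all_boot all_order all_algebra.
From mathcomp Require Import all_classical all_reals all_analysis.
From mathcomp Require Import ring lra.

Set Implicit Arguments.
Unset Strict Implicit.
Unset Printing Implicit Defensive.

Import Order.TTheory GRing.Theory Num.Theory.

Local Open Scope classical_set_scope.
Local Open Scope ring_scope.

(* [Quat a b c d] is a + b i + c j + d k. *)
Record quat (R : realType) := Quat { qre : R; qi : R; qj : R; qk : R }.

Section QuatSkewField.
Variable R : realType.
Implicit Types x y z : quat R.

Definition tuple_of_quat x : R * R * R * R := (qre x, qi x, qj x, qk x).
Definition quat_of_tuple (t : R * R * R * R) : quat R :=
  let: (a, b, c, d) := t in Quat a b c d.

Lemma tuple_of_quatK : cancel tuple_of_quat quat_of_tuple.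
Proof. by case. Qed.

HB.instance Definition _ := Choice.copy (quat R) (can_type tuple_of_quatK).

Definition quat_zero : quat R := Quat 0 0 0 0.
Definition quat_one : quat R := Quat 1 0 0 0.
Definition quat_opp x : quat R := Quat (- qre x) (- qi x) (- qj x) (- qk x).
Definition quat_add x y : quat R :=
  Quat (qre x + qre y) (qi x + qi y) (qj x + qj y) (qk x + qk y).

(* Hamilton product: i^2 = j^2 = k^2 = ijk = -1. *)
Definition quat_mul x y : quat R :=
  Quat (qre x * qre y - qi x * qi y - qj x * qj y - qk x * qk y)
       (qre x * qi y + qi x * qre y + qj x * qk y - qk x * qj y)
       (qre x * qj y - qi x * qk y + qj x * qre y + qk x * qi y)
       (qre x * qk y + qi x * qj y - qj x * qi y + qk x * qre y).

Lemma quat_addA : associative quat_add.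
Proof. by move=> [? ? ? ?] [? ? ? ?] [? ? ? ?]; congr Quat => /=; ring. Qed.
Lemma quat_addC : commutative quat_add.
Proof. by move=> [? ? ? ?] [? ? ? ?]; congr Quat => /=; ring. Qed.
Lemma quat_add0 : left_id quat_zero quat_add.
Proof. by move=> [? ? ? ?]; congr Quat => /=; ring. Qed.
Lemma quat_addN : left_inverse quat_zero quat_opp quat_add.
Proof. by move=> [? ? ? ?]; congr Quat => /=; ring. Qed.

HB.instance Definition _ :=
  GRing.isZmodule.Build (quat R) quat_addA quat_addC quat_add0 quat_addN.

Lemma quat_mulA : associative quat_mul.
Proof. by move=> [? ? ? ?] [? ? ? ?] [? ? ? ?]; congr Quat => /=; ring. Qed.
Lemma quat_mul1 : left_id quat_one quat_mul.
Proof. by move=> [? ? ? ?]; congr Quat => /=; ring. Qed.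
Lemma quat_mulr1 : right_id quat_one quat_mul.
Proof. by move=> [? ? ? ?]; congr Quat => /=; ring. Qed.
Lemma quat_mulDl : left_distributive quat_mul +%R.
Proof. by move=> [? ? ? ?] [? ? ? ?] [? ? ? ?]; congr Quat => /=; ring. Qed.
Lemma quat_mulDr : right_distributive quat_mul +%R.
Proof. by move=> [? ? ? ?] [? ? ? ?] [? ? ? ?]; congr Quat => /=; ring. Qed.
Lemma quat_one_neq0 : quat_one != 0.
Proof. by apply/eqP => -[] /eqP; rewrite oner_eq0. Qed.

HB.instance Definition _ := GRing.Zmodule_isNzRing.Build (quat R)
  quat_mulA quat_mul1 quat_mulr1 quat_mulDl quat_mulDr quat_one_neq0.

Definition quat_sqnorm x : R := qre x ^+ 2 + qi x ^+ 2 + qj x ^+ 2 + qk x ^+ 2.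

Definition quat_inv x : quat R :=
  Quat (qre x / quat_sqnorm x) (- qi x / quat_sqnorm x)
       (- qj x / quat_sqnorm x) (- qk x / quat_sqnorm x).

Lemma quat_sqnorm_eq0 x : (quat_sqnorm x == 0) = (x == 0).
Proof.
apply/eqP/eqP => [|->]; last by rewrite /quat_sqnorm /= expr0n /= !addr0.
case: x => a b c d; rewrite /quat_sqnorm /= => /eqP.
rewrite !paddr_eq0 ?addr_ge0 ?sqr_ge0// !sqrf_eq0.
by move=> /andP[/andP[/andP[/eqP-> /eqP->] /eqP->] /eqP->].
Qed.

Lemma quat_mulV : {in [pred x | x != 0], left_inverse 1 quat_inv *%R}.
Proof.
move=> x; rewrite inE -quat_sqnorm_eq0 /quat_sqnorm.
by case: x => a b c d /= n0; congr Quat; rewrite /= /quat_sqnorm /=; field.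
Qed.
Lemma quat_mulrV : {in [pred x | x != 0], right_inverse 1 quat_inv *%R}.
Proof.
move=> x; rewrite inE -quat_sqnorm_eq0 /quat_sqnorm.
by case: x => a b c d /= n0; congr Quat; rewrite /= /quat_sqnorm /=; field.
Qed.
Lemma quat_unit x y : y * x = 1 /\ x * y = 1 -> [pred x | x != 0] x.
Proof.
move=> [yx _]; apply/eqP => x0.
by move: yx; rewrite x0 mulr0 => /esym/eqP; rewrite oner_eq0.
Qed.
Lemma quat_inv_out : {in [predC [pred x | x != 0]], quat_inv =1 id}.
Proof.
move=> x; rewrite !inE negbK => /eqP->.
by congr Quat; rewrite /= ?oppr0 mul0r.
Qed.

HB.instance Definition _ := GRing.NzRing_hasMulInverse.Build (quat R)
  quat_mulV quat_mulrV quat_unit quat_inv_out.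

End QuatSkewField.

Definition quat_real (R : realType) (a : R) : quat R := Quat a 0 0 0.

Definition quat_abs (R : realType) (x : quat R) : R :=
  Num.sqrt (quat_sqnorm x).

(* The scalar acts on the right, whereas [*:] would act on the left. *)
Definition right_eigenvalue (R : realType) (n : nat)
    (A : 'M[quat R]_n) (lambda : quat R) : Prop :=
  exists x : 'cV[quat R]_n, x != 0 /\ A *m x = \col_i (x i 0 * lambda).

Definition right_spectrum (R : realType) (n : nat) (A : 'M[quat R]_n) :
    set (quat R) :=
  [set lambda | right_eigenvalue A lambda].

Definition row_sum (R : realType) (n : nat) (A : 'M[quat R]_n) (i : 'I_n) : R :=
  \sum_(j < n | j != i) quat_abs (A i j).

Definition row_pnorm (R : realType) (n : nat) (p : R) (A : 'M[quat R]_n)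
    (i : 'I_n) : R :=
  (\sum_(j < n | j != i) quat_abs (A i j) `^ p) `^ (1 / p).

(* [powR] satisfies 0 `^ 0 = 1 and 0 `^ a = 0 for a != 0. *)
Definition gen_ball (R : realType) (n : nat) (gamma p q : R)
    (A : 'M[quat R]_n) (i : 'I_n) : set (quat R) :=
  [set z | quat_abs (z - A i i) <=
           (n%:R - 1) `^ ((1 - gamma) / q) * row_sum A i `^ gamma *
           row_pnorm p A i `^ (1 - gamma)].

(* Main.v *)
Require Import Defs.
From mathcomp Require Import all_boot all_order all_algebra.
From mathcomp Require Import all_classical all_reals all_analysis.
From mathcomp Require Import ring.

Import Order.TTheory GRing.Theory Num.Theory.

Local Open Scope classical_set_scope.
Local Open Scope ring_scope.

(** The argument is Gershgorin's, followed by Hoelder's inequality.  Let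
    [A x = x lambda] and let [x i] be an entry of [x] of largest modulus.  As
    [a_ii] is real it commutes with [x i], so row [i] of the eigenvalue equation
    reads [x i (lambda - a_ii) = \sum_(j != i) a_ij x j]; taking moduli and
    dividing by [|x i|] gives [|lambda - a_ii| <= r_i]
    ([gershgorin_right_spectrum]).  Two facts about quaternions are needed: the
    modulus is multiplicative (Euler's four-square identity) and satisfies the
    triangle inequality.

    Hoelder's inequality against the constant [1] bounds [r_i] by
    [(n - 1)^(1/q) n_i^(p)] ([ler_sum_pnorm]).  Writing
    [r_i = r_i^gamma r_i^(1 - gamma)] and applying this bound to the second
    factor alone gives the radius of the generalized ball. *)

Section QuatModulus.
Context {R : realType}.
Implicit Types x y : quat R.

Lemma quat_sqnorm_ge0 x : 0 <= quat_sqnorm x.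
Proof. by rewrite !addr_ge0 ?sqr_ge0. Qed.

Lemma quat_sqnormM x y : quat_sqnorm (x * y) = quat_sqnorm x * quat_sqnorm y.
Proof. by case: x y => [? ? ? ?] [? ? ? ?]; rewrite /quat_sqnorm /=; ring. Qed.

Lemma quat_abs_ge0 x : 0 <= quat_abs x.
Proof. exact: sqrtr_ge0. Qed.

Lemma quat_abs0 : quat_abs (0 : quat R) = 0.
Proof.
by apply/eqP; rewrite sqrtr_eq0 le_eqVlt quat_sqnorm_eq0 eqxx.
Qed.

Lemma quat_abs_gt0 x : (0 < quat_abs x) = (x != 0).
Proof.
by rewrite sqrtr_gt0 lt_neqAle quat_sqnorm_ge0 andbT eq_sym quat_sqnorm_eq0.
Qed.

Lemma quat_absM x y : quat_abs (x * y) = quat_abs x * quat_abs y.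
Proof. by rewrite /quat_abs quat_sqnormM sqrtrM ?quat_sqnorm_ge0. Qed.

(** After squaring, this is the Cauchy-Schwarz inequality in [R^4], which holds
    because [|x|^2 |y|^2 - <x, y>^2] is the squared norm of the imaginary part
    of [x] times the conjugate of [y]. *)
Lemma quat_abs_add_le x y : quat_abs (x + y) <= quat_abs x + quat_abs y.
Proof.
rewrite -ler_sqr ?nnegrE ?addr_ge0 ?quat_abs_ge0// sqrrD.
rewrite !sqr_sqrtr ?quat_sqnorm_ge0// -sqrtrM ?quat_sqnorm_ge0//.
pose dot := qre x * qre y + qi x * qi y + qj x * qj y + qk x * qk y.
have -> : quat_sqnorm (x + y) = quat_sqnorm x + dot *+ 2 + quat_sqnorm y.
  by case: x y @dot => [? ? ? ?] [? ? ? ?]; rewrite /quat_sqnorm /=; ring.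
rewrite lerD2r lerD2l lerMn2r /=.
apply: (le_trans (ler_norm _)); rewrite -sqrtr_sqr ler_wsqrtr// -quat_sqnormM.
pose ybar := Quat (qre y) (- qi y) (- qj y) (- qk y).
have -> : quat_sqnorm (x * y) = quat_sqnorm (x * ybar).
  by rewrite !quat_sqnormM /quat_sqnorm /= !sqrrN.
have -> : dot = qre (x * ybar) by rewrite /dot /=; ring.
by rewrite [leRHS]/quat_sqnorm -!addrA lerDl !addr_ge0 ?sqr_ge0.
Qed.

Lemma quat_abs_sum_le (I : Type) (r : seq I) (P : pred I) (F : I -> quat R) :
  quat_abs (\sum_(i <- r | P i) F i) <= \sum_(i <- r | P i) quat_abs (F i).
Proof.
apply: (big_ind2 (fun x a => quat_abs x <= a)) => //; first by rewrite quat_abs0.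
by move=> x a y b xa yb; apply: le_trans (quat_abs_add_le _ _) (lerD xa yb).
Qed.

Lemma quat_real_comm (a : R) x : quat_real a * x = x * quat_real a.
Proof. by case: x => ? ? ? ?; congr Quat => /=; ring. Qed.

End QuatModulus.

(** For a diagonal entry that does not commute with the eigenvector, the same
    computation bounds only [|x i lambda (x i)^-1 - a_ii|]; a real diagonal
    makes this the distance from [lambda] itself. *)
Lemma gershgorin_right_spectrum (R : realType) (n : nat) (A : 'M[quat R]_n)
    (lambda : quat R) :
    (forall i, exists a : R, A i i = quat_real a) ->
    right_eigenvalue A lambda ->
  exists i, quat_abs (lambda - A i i) <= row_sum A i.
Proof.
move=> A_diag_real [x [x_neq0 Axl]].
have [i0 xi0_neq0] : exists i, x i 0 != 0.
  apply/existsP; apply: contraNT x_neq0 => /existsPn x0.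
  by apply/eqP/colP => i; apply/eqP; rewrite mxE -[_ == _]negbK x0.
case: (@arg_maxP _ _ _ i0 xpredT (fun i => quat_abs (x i 0)) isT) => i _ xi_max.
have xi_gt0 : 0 < quat_abs (x i 0).
  by apply: lt_le_trans (xi_max i0 isT); rewrite quat_abs_gt0.
exists i; rewrite -(ler_pM2l xi_gt0) -quat_absM.
have -> : x i 0 * (lambda - A i i) = \sum_(j < n | j != i) A i j * x j 0.
  have /matrixP /(_ i 0) := Axl; rewrite !mxE (bigD1 i) //=.
  have [a ->] := A_diag_real i.
  by rewrite mulrBr -quat_real_comm => <-; rewrite addrAC subrr add0r.
apply: le_trans (quat_abs_sum_le _ _ _ _) _.
rewrite /row_sum mulr_sumr; apply: ler_sum => j _.
by rewrite quat_absM mulrC ler_wpM2r ?quat_abs_ge0//; exact: xi_max.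
Qed.

Section FiniteHoelder.
Context {R : realType} {I : finType}.
Implicit Types (P : pred I) (F G : I -> R) (p q : R).

Lemma sum_powR_eq0 P F p : p != 0 ->
  \sum_(i | P i) F i `^ p = 0 -> forall i, P i -> F i = 0.
Proof.
move=> p_neq0 /psumr_eq0P F0 i Pi.
have /eqP := F0 (fun _ _ => powR_ge0 _ _) i Pi.
by rewrite powR_eq0 => /andP[/eqP].
Qed.

(** Summing over [i] Young's inequalities [F i G i <= (F i)^p / p + (G i)^q / q]
    gives Hoelder's inequality for functions of norm [1]. *)
Lemma ler_sum_hoelder_normalized P F G p q :
    (forall i, P i -> 0 <= F i) -> (forall i, P i -> 0 <= G i) ->
    0 < p -> 0 < q -> p^-1 + q^-1 = 1 ->
    \sum_(i | P i) F i `^ p = 1 -> \sum_(i | P i) G i `^ q = 1 ->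
  \sum_(i | P i) F i * G i <= 1.
Proof.
move=> F_ge0 G_ge0 p_gt0 q_gt0 pq F1 G1.
have young : \sum_(i | P i) (F i `^ p / p + G i `^ q / q) = 1.
  by rewrite big_split /= -!mulr_suml F1 G1 !mul1r.
rewrite -young; apply: ler_sum => i Pi.
exact: conjugate_powR (F_ge0 i Pi) (G_ge0 i Pi) p_gt0 q_gt0 pq.
Qed.

Lemma sum_powR_normalized P F p : 0 < p -> (forall i, P i -> 0 <= F i) ->
    0 < \sum_(i | P i) F i `^ p ->
  \sum_(i | P i) (F i / (\sum_(j | P j) F j `^ p) `^ p^-1) `^ p = 1.
Proof.
move=> p_gt0 F_ge0; move S_def : (\sum_(i | P i) F i `^ p) => S S_gt0.
transitivity ((\sum_(i | P i) F i `^ p) / S); last first.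
  by rewrite S_def divff ?lt0r_neq0.
rewrite mulr_suml; apply: eq_bigr => i Pi.
rewrite powRM ?F_ge0 ?invr_ge0 ?powR_ge0//.
rewrite -powR_inv1 ?powR_ge0// -!powRrM mulrCA.
by rewrite mulVf ?gt_eqF// mulr1 powR_inv1 ?ltW.
Qed.

Lemma ler_sum_hoelder P F G p q :
    (forall i, P i -> 0 <= F i) -> (forall i, P i -> 0 <= G i) ->
    0 < p -> 0 < q -> p^-1 + q^-1 = 1 ->
  \sum_(i | P i) F i * G i <=
    (\sum_(i | P i) F i `^ p) `^ p^-1 * (\sum_(i | P i) G i `^ q) `^ q^-1.
Proof.
move=> F_ge0 G_ge0 p_gt0 q_gt0 pq.
have F1 := sum_powR_normalized P F p p_gt0 F_ge0.
have G1 := sum_powR_normalized P G q q_gt0 G_ge0.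
have F0 := @sum_powR_eq0 P F p (lt0r_neq0 p_gt0).
have G0 := @sum_powR_eq0 P G q (lt0r_neq0 q_gt0).
have S_ge0 : 0 <= \sum_(i | P i) F i `^ p.
  by apply: sumr_ge0 => i _; apply: powR_ge0.
have T_ge0 : 0 <= \sum_(i | P i) G i `^ q.
  by apply: sumr_ge0 => i _; apply: powR_ge0.
move: (\sum_(i | P i) F i `^ p) S_ge0 F0 F1 => S.
move: (\sum_(i | P i) G i `^ q) T_ge0 G0 G1 => T.
(* If one of the two norms vanishes, then so does every product [F i * G i]. *)
rewrite le0r => /predU1P[-> G0 _ _ _ _|T_gt0 _ G1].
  by rewrite big1 ?mulr_ge0 ?powR_ge0// => i Pi; rewrite G0 ?mulr0.
rewrite le0r => /predU1P[-> F0 _|S_gt0 _ F1].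
  by rewrite big1 ?mulr_ge0 ?powR_ge0// => i Pi; rewrite F0 ?mul0r.
move: (S `^ p^-1) (powR_gt0 p^-1 S_gt0) (F1 S_gt0) => N N_gt0 {}F1.
move: (T `^ q^-1) (powR_gt0 q^-1 T_gt0) (G1 T_gt0) => M M_gt0 {}G1.
rewrite -[N * M]mul1r -(ler_pdivrMr _ _ (mulr_gt0 N_gt0 M_gt0)) mulr_suml.
under eq_bigr => i Pi do rewrite invfM mulrACA.
apply: ler_sum_hoelder_normalized p_gt0 q_gt0 pq F1 G1 => i Pi.
  by rewrite divr_ge0 ?F_ge0// ltW.
by rewrite divr_ge0 ?G_ge0// ltW.
Qed.

Lemma ler_sum_pnorm P F p q : (forall i, P i -> 0 <= F i) ->
    0 < p -> 0 < q -> p^-1 + q^-1 = 1 ->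
  \sum_(i | P i) F i <=
    #|P|%:R `^ q^-1 * (\sum_(i | P i) F i `^ p) `^ p^-1.
Proof.
move=> F_ge0 p_gt0 q_gt0 pq.
have <- : \sum_(i | P i) 1 `^ q = #|P|%:R :> R.
  by under eq_bigr do rewrite powR1; rewrite sumr_const.
rewrite mulrC; under eq_bigr => i _ do rewrite -[F i]mulr1.
by apply: (ler_sum_hoelder P F (fun=> 1)) => // i _; apply: ler01.
Qed.

End FiniteHoelder.

Lemma row_sum_ge0 (R : realType) (n : nat) (A : 'M[quat R]_n) (i : 'I_n) :
  0 <= row_sum A i.
Proof. by apply: sumr_ge0 => j _; apply: quat_abs_ge0. Qed.

Lemma row_sum_le_pnorm (R : realType) (n : nat) (A : 'M[quat R]_n) (i : 'I_n)
    (p q : R) : 0 < p -> 0 < q -> p^-1 + q^-1 = 1 ->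
  row_sum A i <= (n%:R - 1) `^ q^-1 * row_pnorm p A i.
Proof.
move=> p_gt0 q_gt0 pq.
have <- : #|predC1 i|%:R = n%:R - 1 :> R.
  by rewrite cardC1 card_ord; case: n A i => [_ []|n _ _] //; rewrite -natr1 addrK.
rewrite /row_pnorm div1r.
by apply: ler_sum_pnorm => // j _; apply: quat_abs_ge0.
Qed.

Theorem theorem3p18 (R : realType) (n : nat) (A : 'M[quat R]_n)
    (A_diag_real : forall i : 'I_n, exists a : R, A i i = quat_real a)
    (gamma : R) (gamma01 : 0 <= gamma <= 1)
    (p q : R) (p_gt1 : 1 < p) (q_gt1 : 1 < q) (pq : 1 / p + 1 / q = 1) :
  right_spectrum A `<=` \bigcup_(i in [set: 'I_n]) gen_ball gamma p q A i.
Proof.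
move=> lambda /(gershgorin_right_spectrum _ _ _ _ A_diag_real)[i lambda_le].
exists i => //; rewrite /gen_ball /=; apply: le_trans lambda_le _.
have [_ gamma_le1] := andP gamma01.
have p_gt0 : 0 < p by apply: lt_trans p_gt1.
have q_gt0 : 0 < q by apply: lt_trans q_gt1.
rewrite !div1r in pq.
(* The exponents add up to [1 != 0], so the splitting also holds when [r_i = 0]
   and [gamma] is [0] or [1], with [0 `^ 0 = 1]. *)
have split_row_sum :
    row_sum A i = row_sum A i `^ gamma * row_sum A i `^ (1 - gamma).
  by rewrite -powRD subrKC ?oner_eq0// powRr1 ?row_sum_ge0.
rewrite {1}split_row_sum mulrAC [leRHS]mulrC ler_wpM2l ?powR_ge0//.
rewrite [_ / q]mulrC powRrM -powRM ?powR_ge0//.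
apply: ge0_ler_powR; rewrite ?subr_ge0 ?nnegrE ?mulr_ge0 ?powR_ge0 ?row_sum_ge0//.
exact: row_sum_le_pnorm.
Qed.
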